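(* The critical exponent $CE_3$ for $3$-by-$3$ generalized doubly nonnegative matrices under continuous conventional powers satisfies $CE_3 = 2$.
   Context: A real $n$-by-$n$ matrix $A$ is called generalized doubly nonnegative (GDN) if it is entrywise nonnegative, diagonalizable, and all its eigenvalues are (real and) nonnegative. For a GDN matrix $A = SDS^{-1}$ with $D=\operatorname{diag}(\lambda_1,\dots,\lambda_n)$ diagonal, and a real number $\alpha>0$, the continuous (conventional) power is $A^\alpha := S D^\alpha S^{-1}$, where $D^\alpha := \operatorname{diag}(\lambda_1^\alpha,\dots,\lambda_n^\alpha)$ (with $0^\alpha = 0$). The critical exponent $CE_n$ is the least real number $m \ge 0$ such that for every $n$-by-$n$ GDN matrix $A$, the matrix $A^\alpha$ is GDN for all $\alpha > m$. *)

(* Defs.v *)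
From mathcomp Require Import all_boot all_order all_algebra.
From mathcomp Require Import all_classical all_reals all_analysis.

Set Implicit Arguments.
Unset Strict Implicit.
Unset Printing Implicit Defensive.

Import Order.TTheory GRing.Theory Num.Theory.
Local Open Scope classical_set_scope.
Local Open Scope ring_scope.

(* [diagonalizable] and [eigenvalue] are taken over R, so that a diagonalizable
   matrix has only real eigenvalues. *)
Definition GDN (R : realType) (n : nat) (A : 'M[R]_n) : Prop :=
  [/\ forall i j, 0 <= A i j,
      diagonalizable A
    & forall a, eigenvalue A a -> 0 <= a].

Definition diag_decomp (R : realType) (n : nat) (A : 'M[R]_n) :
    set ('M[R]_n * 'rV[R]_n) :=
  [set SD | SD.1 \in unitmx /\ A = SD.1 *m diag_mx SD.2 *m invmx SD.1].

(* The decomposition is chosen arbitrarily; by [cpowE] the power does not depend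
   on the choice. The value is meaningful only when A has such a decomposition with
   D nonnegative and a > 0, in which case [powR 0 a = 0]. *)
Definition cpow (R : realType) (n : nat) (A : 'M[R]_n) (a : R) : 'M[R]_n :=
  let: (V, D) := xget (1%:M, 0) (diag_decomp A) in
  V *m diag_mx (map_mx (fun x => x `^ a) D) *m invmx V.

Lemma cpowE (R : realType) (n : nat) (A S : 'M[R]_n) (D : 'rV[R]_n) (a : R) :
  S \in unitmx -> A = S *m diag_mx D *m invmx S ->
  cpow A a = S *m diag_mx (map_mx (fun x => x `^ a) D) *m invmx S.
Proof.
move=> Su AE; rewrite /cpow.
have /(xgetI (1%:M, 0)) : diag_decomp A (S, D) by split.
case: (xget _ _) => T E [/= Tu AE'].
pose P := invmx T *m S; have SE : S = T *m P by rewrite /P mulKVmx.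
have EP : diag_mx E *m P = P *m diag_mx D.
  have : T *m diag_mx E *m invmx T *m S = S *m diag_mx D by rewrite -AE' AE mulmxKV.
  by move/(congr1 (mulmx (invmx T))); rewrite -!mulmxA mulKmx // /P !mulmxA.
clearbody P.
have EPa : diag_mx (map_mx (fun x => x `^ a) E) *m P =
           P *m diag_mx (map_mx (fun x => x `^ a) D).
  apply/matrixP => i j; move/matrixP/(_ i j): EP.
  rewrite !mul_diag_mx !mul_mx_diag !mxE mulrC.
  have [->|P0] := eqVneq (P i j) 0; first by rewrite !mul0r mulr0.
  by move/(mulfI P0) => ->; rewrite mulrC.
have -> : invmx T = P *m invmx S.
  by rewrite -[P](mulKmx Tu) -SE -mulmxA mulmxV // mulmx1.
by rewrite mulmxA -(mulmxA T) EPa mulmxA -SE.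
Qed.

Lemma diag_decomp_ex (R : realType) (n : nat) (A : 'M[R]_n) :
  diagonalizable A -> exists SD, diag_decomp A SD.
Proof.
case=> P Pu /(diagonalizable_forLR Pu)[D AE].
have Vu : invmx P \in unitmx by rewrite unitmx_inv.
by exists (invmx P, D); split=> //; rewrite AE; exact: conjumx.
Qed.

Definition preserving_bounds (R : realType) (n : nat) : set R :=
  [set m | 0 <= m /\
     forall A : 'M[R]_n, GDN A -> forall a : R, m < a -> GDN (cpow A a)].
Arguments preserving_bounds : clear implicits.

(* CE_n = m; a relation, since a least element is unique but need not exist
   a priori. *)
Definition is_critical_exponent (R : realType) (n : nat) (m : R) : Prop :=
  preserving_bounds R n m /\ lbound (preserving_bounds R n) m.

(* Main.v *)
(** Write A = S D S^-1. Each entry of A^t is a real exponential sum in t with at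
    most three terms, and a nonzero exponential sum with N terms has fewer than N
    real zeros (divide by one exponential, differentiate, apply Rolle). At integers
    t the entry is nonnegative, since A^t is then an ordinary power; a negative
    value at some t > 2 would force two zeros between consecutive integers, and
    together with zeros at 0 or 1 this exceeds the bound.

    Conversely 2 is optimal because there is a GDN matrix A, with eigenvalues
    1, 3, 9, such that A and A^2 both have a zero (0,0) entry: the (0,0) entry of
    A^t is then (3^t - 3)(3^t - 9) / 16, which is negative for 1 < t < 2. *)
Require Import Defs.
From mathcomp Require Import all_boot all_order all_algebra.
From mathcomp Require Import all_classical all_reals all_analysis.
From mathcomp Require Import ring lra.
Local Open Scope ring_scope.

Set Implicit Arguments.
Unset Strict Implicit.
Unset Printing Implicit Defensive.

Import Order.TTheory GRing.Theory Num.Theory.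
Import numFieldNormedType.Exports.

(** * Zeros of real exponential sums *)

Section ExpSum.
Variable R : realType.
Implicit Types (s : seq (R * R)) (z : seq R).

Definition expsum s (t : R) : R := \sum_(p <- s) p.1 * expR (p.2 * t).

Lemma expsum_cons p s t :
  expsum (p :: s) t = p.1 * expR (p.2 * t) + expsum s t.
Proof. by rewrite /expsum big_cons. Qed.

Definition dexpsum s := [seq (p.1 * p.2, p.2) | p <- s].

Lemma is_derive_expsum s (t : R) :
  is_derive t 1 (expsum s) (expsum (dexpsum s) t).
Proof.
elim: s => [|[c b] s IH].
  have -> : expsum [::] = cst 0 by apply/funext => x; rewrite /expsum big_nil.
  exact: is_derive_cst.
have -> : expsum ((c, b) :: s) = (c *: (expR \o ( *%R b))) + expsum s.
  by apply/funext => x; rewrite expsum_cons.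
rewrite /= expsum_cons /=.
have dM : is_derive t 1 ( *%R b) b.
  have := @is_deriveZ _ _ _ (@id R) b t 1 1 (is_derive_id _ _).
  by rewrite /GRing.scale/= mulr1.
apply: is_deriveD.
have -> : c * b * expR (b * t) = c *: (expR (b * t) * b).
  by rewrite /GRing.scale/=; ring.
apply: is_deriveZ.
Qed.

Lemma expsum_within_continuous s (A : set R) :
  {within A, continuous (expsum s)}%classic.
Proof.
apply: continuous_subspaceT => t.
apply/differentiable_continuous/derivable1_diffP.
by have [] := is_derive_expsum s t.
Qed.

(** Splitting off the least zero [x] records that exactly one zero is lost on differentiating. The
    bound [x < w] on the new zeros lets the induction prepend a Rolle point from the gap to the
    left. *)
Lemma Rolle_path s x z :
  path <%R x z -> {in x :: z, forall t, expsum s t = 0} ->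
  exists w, [/\ size w = size z, path <%R x w &
    {in w, forall t, expsum (dexpsum s) t = 0}].
Proof.
elim: z x => [|y z IH] x /=; first by move=> _ _; exists [::].
move=> /andP[xy pz] z0.
have [w [sw pw w0]] := IH y pz (fun t tz => z0 t (mem_behead (s := _ :: _) tz)).
have [|||c] := @Rolle _ (expsum s) x y xy.
- by move=> t _; have [] := is_derive_expsum s t.
- exact: expsum_within_continuous.
- by rewrite !z0 ?inE ?eqxx ?orbT.
rewrite in_itv/= => /andP[xc cy] [_ dc].
exists (c :: w); split => /=; first by rewrite sw.
  rewrite xc/=; case: w pw {sw w0} => //= v w /andP[yv ->].
  by rewrite (lt_trans cy yv).
move=> t; rewrite inE => /predU1P[->|]; last exact: w0.
by have [_ <-] := is_derive_expsum s c.
Qed.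

Lemma expsum_sorted_zeros s z :
  sorted <%R z -> (size s <= size z)%N ->
  {in z, forall t, expsum s t = 0} -> forall t, expsum s t = 0.
Proof.
elim: {s}(size s) {-2}s (erefl (size s)) z => [|n IH] s.
  by move=> /size0nil -> z _ _ _ t; rewrite /expsum big_nil.
case: s => // -[c b] s [ss] [|x z] //= xz; rewrite ss ltnS => sz z0.
(* Factoring out one exponential makes its term constant, so that
   differentiation removes it. *)
pose u := [seq (p.1, p.2 - b) | p <- s].
have uE t : expsum ((c, b) :: s) t = expR (b * t) * expsum ((c, 0) :: u) t.
  rewrite !expsum_cons /= mul0r expR0 mulr1 mulrDr mulrC; congr (_ + _).
  rewrite /expsum big_map mulr_sumr; apply: eq_bigr => -[d e] _ /=.
  by rewrite mulrCA -expRD; congr (_ * expR _); ring.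
have u0 : {in x :: z, forall t, expsum ((c, 0) :: u) t = 0}.
  move=> t /z0 /eqP; rewrite uE mulf_eq0 => /predU1P[/eqP|/eqP//].
  by rewrite expR_eq0.
have [w [sw pw w0]] := Rolle_path xz u0.
have dE t : expsum (dexpsum ((c, 0) :: u)) t = expsum (dexpsum u) t.
  by rewrite /= expsum_cons /= mulr0 mul0r add0r.
have du0 t : expsum (dexpsum u) t = 0.
  apply: (IH _ _ w) => //; first by rewrite !size_map.
  - exact: path_sorted pw.
  - by rewrite !size_map ss sw.
  - by move=> v /w0; rewrite dE.
move=> t; rewrite uE; apply/eqP; rewrite mulf_eq0; apply/orP; right.
(* The quotient has zero derivative, so it is constant, and it vanishes at [x]. *)
have -> : expsum ((c, 0) :: u) t = expsum ((c, 0) :: u) x.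
  apply: is_derive_0_is_cst => v; have := is_derive_expsum ((c, 0) :: u) v.
  by rewrite dE du0.
by rewrite u0 ?mem_head.
Qed.

Lemma expsum_zeros s z :
  uniq z -> (size s <= size z)%N ->
  {in z, forall t, expsum s t = 0} -> forall t, expsum s t = 0.
Proof.
move=> uz sz z0; apply: (@expsum_sorted_zeros _ (sort <=%R z)).
- by rewrite sort_lt_sorted.
- by rewrite size_sort.
- by move=> t; rewrite mem_sort; exact: z0.
Qed.

(* A sign change would add a zero on each side of [t]. *)
Lemma expsum_ge0 s z (a b t : R) :
  uniq z -> (size s <= (size z).+2)%N ->
  {in z, forall v, v < a /\ expsum s v = 0} ->
  0 <= expsum s a -> 0 <= expsum s b -> a <= t <= b -> 0 <= expsum s t.
Proof.
move=> uz sz z0 a0 b0 /andP[at_ tb]; rewrite leNgt; apply/negP => t0.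
have [||v] := @IVT _ (expsum s) a t 0 at_; first exact: expsum_within_continuous.
  by rewrite ge_min le_max a0 (ltW t0) orbT.
rewrite in_itv/= => /andP[av vt] v0.
have [||w] := @IVT _ (expsum s) t b 0 tb; first exact: expsum_within_continuous.
  by rewrite ge_min le_max b0 (ltW t0) orbT.
rewrite in_itv/= => /andP[tw wb] w0.
have vt' : v < t.
  by rewrite lt_neqAle vt andbT; apply: contraTneq t0 => <-; rewrite v0 ltxx.
suff : expsum s t = 0 by move=> t00; rewrite t00 ltxx in t0.
apply: (@expsum_zeros _ (v :: w :: z)) => //=.
- rewrite uz inE (lt_eqF (lt_le_trans vt' tw)) /=.
  by apply/and3P; split=> //; apply/negP => /z0[]; lra.
- by move=> x; rewrite !inE => /or3P[/eqP->|/eqP->|/z0[]].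
Qed.

End ExpSum.

(** * Nonnegativity of powers of GDN matrices *)

Section GDNPower.
Variable R : realType.

Lemma conj_diagE n (S : 'M[R]_n) (D : 'rV[R]_n) i j :
  (S *m diag_mx D *m invmx S) i j = \sum_k S i k * D 0 k * invmx S k j.
Proof. by rewrite mxE; apply: eq_bigr => k _; rewrite mul_mx_diag mxE. Qed.

(** If [v] is a left eigenvector, [v *m S] is one of the diagonal matrix, and any nonzero coordinate
    of it identifies the eigenvalue with an entry of [D]. *)
Lemma GDN_conj_diag n (S : 'M[R]_n) (D : 'rV[R]_n) :
  S \in unitmx -> (forall k, 0 <= D 0 k) ->
  (forall i j, 0 <= (S *m diag_mx D *m invmx S) i j) ->
  GDN (S *m diag_mx D *m invmx S).
Proof.
move=> Su D0 A0; split => //.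
  have Vu : invmx S \in unitmx by rewrite unitmx_inv.
  exists (invmx S) => //; apply/(similar_diagLR Vu); exists D.
  by rewrite conjumx ?invmxK.
move=> a /eigenvalueP[v vA v0].
have vSD : v *m S *m diag_mx D = a *: (v *m S).
  by rewrite scalemxAl -vA -!mulmxA mulVmx// mulmx1.
have : v *m S != 0.
  apply: contra_neq v0 => /(congr1 (mulmx^~ (invmx S))).
  by rewrite mulmxK ?mul0mx.
case/rV0Pn => k vSk.
move/rowP/(_ k): vSD; rewrite mul_mx_diag !mxE mulrC => /mulIf <- //.
by rewrite mxE in vSk.
Qed.

(** The rows of [invmx S] are left eigenvectors, so the entries of [D] are eigenvalues. *)
Lemma GDN_decomp n (A : 'M[R]_n) : GDN A ->
  exists S D, [/\ S \in unitmx, A = S *m diag_mx D *m invmx S &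
                  forall k, 0 <= D 0 k].
Proof.
case=> _ /diag_decomp_ex[[S D] /= [Su AE]] A0; exists S, D; split => // k.
apply: A0; apply/eigenvalueP; exists (row k (invmx S)).
  rewrite AE -!row_mul !mulmxA mulVmx// mul1mx.
  by apply/rowP => j; rewrite mul_diag_mx !mxE.
rewrite rowE mulmx_free_eq0 ?row_free_unit ?unitmx_inv//.
by apply/rV0Pn; exists k; rewrite !mxE !eqxx oner_neq0.
Qed.

(** For singular [A] the case [m = 0] rests on the convention that [powR 0 0] is 1. *)
Lemma cpow_natr n (A : 'M[R]_n.+1) m : GDN A -> cpow A m%:R = A ^+ m.
Proof.
case/GDN_decomp => S [D [Su AE D0]]; rewrite (cpowE _ Su AE).
have -> : diag_mx (map_mx (fun x => x `^ m%:R) D) = diag_mx D ^+ m.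
  elim: m => [|m IH].
    by apply/matrixP => i j; rewrite expr0 !mxE powRr0.
  rewrite exprS -IH; apply/matrixP => i j.
  rewrite -[_ * _]/(_ *m _) mul_diag_mx !mxE -natr1 powRD ?powRr1// ?mulrnAr.
    by rewrite mulrC.
  by rewrite natr1 pnatr_eq0.
rewrite AE; elim: m => [|m IH]; first by rewrite !expr0 mulmx1 mulmxV.
rewrite [in RHS]exprS -IH exprS -![_ * _]/(_ *m _).
by rewrite !mulmxA mulmxKV.
Qed.

Lemma expmx_ge0 n (A : 'M[R]_n.+1) m i j :
  (forall i j, 0 <= A i j) -> 0 <= (A ^+ m) i j.
Proof.
move=> A0; elim: m i j => [|m IH] i j; first by rewrite expr0 mxE ler0n.
by rewrite exprS mxE sumr_ge0// => k _; rewrite mulr_ge0.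
Qed.

(** The walk that stays at [i] contributes [A i i ^+ m]; all other closed walks have nonnegative
    weight. *)
Lemma expmx_diag_ge n (A : 'M[R]_n.+1) m i :
  (forall i j, 0 <= A i j) -> A i i ^+ m <= (A ^+ m) i i.
Proof.
move=> A0; elim: m => [|m IH]; first by rewrite !expr0 mxE eqxx.
rewrite !exprS mxE (bigD1 i)//= ler_wpDr ?ler_wpM2l//.
by rewrite sumr_ge0// => k _; rewrite mulr_ge0// expmx_ge0.
Qed.

(* Zero eigenvalues are left out: they contribute nothing to a power with nonzero
   exponent. *)
Lemma cpow_expsum n (A S : 'M[R]_n) (D : 'rV[R]_n) i j t :
  S \in unitmx -> A = S *m diag_mx D *m invmx S -> (forall k, 0 <= D 0 k) ->
  t != 0 \/ (forall k, 0 < D 0 k) ->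
  cpow A t i j = expsum [seq (S i k * invmx S k j, ln (D 0 k)) |
                          k <- enum 'I_n & 0 < D 0 k] t.
Proof.
move=> Su AE D0 tD; rewrite (cpowE _ Su AE) conj_diagE.
rewrite /expsum big_map big_filter big_enum_cond [RHS]big_mkcond/=.
apply: eq_bigr => k _; rewrite mxE /powR.
have [Dk|] := ltP 0 (D 0 k); first by rewrite gt_eqF// mulrAC [t * _]mulrC.
rewrite le_eqVlt ltNge D0 orbF => /eqP Dk; rewrite Dk eqxx.
case: tD => [/negPf->|/(_ k)]; first by rewrite mulr0 mul0r.
by rewrite Dk ltxx.
Qed.

(* If the entry were negative at [t] in [n, n+1] with n >= 2, it would vanish twice
   there; subtracting [(A i i)^t] on the diagonal keeps the function nonnegative
   at integers and creates zeros at 0 and 1. *)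
Lemma cpow3_ge0 (A : 'M[R]_3) t i j : GDN A -> 2 <= t -> 0 <= cpow A t i j.
Proof.
move=> GA t2; have [A0 _ _] := GA.
have [S [D [Su AE D0]]] := GDN_decomp GA.
pose f u := cpow A u i j.
have fn m : f m%:R = (A ^+ m) i j by rewrite /f cpow_natr.
have fn0 m : 0 <= f m%:R by rewrite fn expmx_ge0.
set n := Num.truncn t.
have tn : n%:R <= t <= n.+1%:R.
  have /truncn_itv/andP[-> /ltW->//] : 0 <= t by apply: le_trans t2.
(* The bound 2 puts the known zeros 0 and 1 strictly to the left of the interval. *)
have n2 : 2%:R <= n%:R :> R.
  by rewrite ler_nat /n truncn_ge_nat//; apply: le_trans t2.
have fE u := @cpow_expsum _ A S D i j u Su AE D0.
set L := [seq _ | k <- _ & _] in fE.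
have sizeL : size L = count (fun k => 0 < D 0 k) (enum 'I_3).
  by rewrite /L size_map size_filter.
have leqL3 : (size L <= 3)%N.
  by rewrite sizeL (leq_trans (count_size _ _))// size_enum_ord.
have sizeL3 : (size L == 3) = [forall k, 0 < D 0 k].
  have -> : (size L == 3) = (size L == size (enum 'I_3)).
    by rewrite size_enum_ord.
  rewrite sizeL -all_count; apply/allP/forallP => [Dp k|Dp k _]; last exact: Dp.
  by apply: Dp; rewrite mem_enum.
have t0 : t != 0 by rewrite gt_eqF//; apply: lt_le_trans t2.
(* A singular matrix leaves at most two terms, so the two zeros from a sign change already
   suffice. *)
have [/forallP Dp|/forallPn[k Dk]] := boolP [forall k, 0 < D 0 k]; last first.
  rewrite fE; last by left.
  apply: (@expsum_ge0 _ L [::] n%:R n.+1%:R) => //=.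
  - rewrite -ltnS ltn_neqAle sizeL3 leqL3 andbT.
    by apply/forallPn; exists k.
  - by rewrite -fE; [exact: fn0|left; rewrite gt_eqF//; lra].
  - by rewrite -fE; [exact: fn0|left].
have {}fE u : f u = expsum L u by apply: fE; right.
have {}fn0 m : 0 <= expsum L m%:R by rewrite -fE.
have f0 : f 0 = (i == j)%:R by rewrite -[0]/(0%:R) fn expr0 mxE.
have f1 : f 1 = A i j by rewrite -[1]/(1%:R) fn expr1.
rewrite -/(f t).
(* Off the diagonal, [A ^+ 0 = 1] supplies the third zero, at 0. *)
have [ij|ij] := eqVneq i j; last first.
  rewrite fE; apply: (@expsum_ge0 _ L [:: 0] n%:R n.+1%:R) => //=.
  by move=> v; rewrite inE => /eqP->; rewrite -fE f0 (negPf ij); split=> //; lra.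
(* A zero diagonal entry is treated apart, since its power is not an exponential; here the third
   zero is at 1. *)
have [r0|r0] := eqVneq (A i j) 0.
  rewrite fE; apply: (@expsum_ge0 _ L [:: 1] n%:R n.+1%:R) => //=.
  by move=> v; rewrite inE => /eqP->; rewrite -fE f1 r0; split=> //; lra.
have {}r0 : 0 < A i j by rewrite lt_neqAle eq_sym r0 A0.
pose L' := (-1, ln (A i j)) :: L.
have L'E u : expsum L' u = f u - A i j `^ u.
  by rewrite expsum_cons -fE mulN1r addrC /powR gt_eqF// [u * _]mulrC.
have L'n m : 0 <= expsum L' m%:R.
  rewrite L'E fn subr_ge0 powR_mulrn//; move: ij => <-; exact: expmx_diag_ge.
rewrite (@le_trans _ _ (A i j `^ t)) ?powR_ge0// -subr_ge0 -L'E.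
apply: (@expsum_ge0 _ L' [:: 0; 1] n%:R n.+1%:R) => //=.
  by rewrite inE eq_sym oner_eq0.
move=> v; rewrite !inE => /orP[]/eqP->; rewrite L'E.
  by rewrite f0 ij eqxx powRr0 subrr; split=> //; lra.
by rewrite f1 powRr1// subrr; split=> //; lra.
Qed.

Lemma GDN_cpow3 (A : 'M[R]_3) t : GDN A -> 2 <= t -> GDN (cpow A t).
Proof.
move=> GA t2; have [S [D [Su AE D0]]] := GDN_decomp GA.
have ge0 i j := cpow3_ge0 i j GA t2.
rewrite (cpowE _ Su AE) in ge0 *; apply: GDN_conj_diag => // k.
by rewrite mxE powR_ge0.
Qed.

(** * A matrix showing that 2 is optimal *)

Definition mx3 (rows : seq (seq R)) : 'M[R]_3 :=
  \matrix_(i, j) nth 0 (nth [::] rows i) j.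

(** Index 0 lies on no closed walk of length 1 or 2. The eigenvalues are powers of 3, so entries of
    the [t]-th power are quadratic polynomials in [3 ^ t]. *)
Definition witness := mx3 [:: [:: 0; 1; 0]; [:: 0; 5; 1]; [:: 27; 1; 8]].
(** The columns are [(1, x, x^2 - 5 x)] for [x] = 1, 3, 9. *)
Definition witness_eigen := mx3 [:: [:: 1; 1; 1]; [:: 1; 3; 9]; [:: -4; -6; 36]].
Definition witness_spec : 'rV[R]_3 := \row_j nth 0 [:: 1; 3; 9] j.
Definition witness_eigenV :=
  mx3 [:: [:: 162 / 96; - (42 / 96); 6 / 96];
          [:: - (72 / 96); 40 / 96; - (8 / 96)];
          [:: 6 / 96; 2 / 96; 2 / 96]].

Lemma witness_eigenVE :
  witness_eigen \in unitmx /\ invmx witness_eigen = witness_eigenV.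
Proof.
have SV : witness_eigen *m witness_eigenV = 1%:M.
  apply/matrixP => -[[|[|[|//]]] hi] [[|[|[|//]]] hj];
    rewrite !(mxE, big_ord_recl, big_ord0) /=; lra.
have [Su _] := mulmx1_unit SV; split=> //.
by rewrite -[RHS](mulKmx Su) SV mulmx1.
Qed.

Lemma witnessE :
  witness = witness_eigen *m diag_mx witness_spec *m invmx witness_eigen.
Proof.
have [_ ->] := witness_eigenVE.
apply/matrixP => -[[|[|[|//]]] hi] [[|[|[|//]]] hj];
  rewrite !(mxE, mul_mx_diag, big_ord_recl, big_ord0) /=; lra.
Qed.

Lemma GDN_witness : GDN witness.
Proof.
have [Su _] := witness_eigenVE; rewrite witnessE; apply: GDN_conj_diag => //.
  by case=> [[|[|[|//]]] hk]; rewrite mxE /=; lra.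
rewrite -witnessE.
by move=> [[|[|[|//]]] hi] [[|[|[|//]]] hj]; rewrite mxE /=; lra.
Qed.

(** The roots 3 and 9 come from the zeros at [t] = 1 and 2; the factor 1/16 gives the value 1 at
    [t = 0]. *)
Lemma cpow_witness t :
  cpow witness t 0 0 = (3 `^ t - 3) * (3 `^ t - 9) / 16.
Proof.
have [Su SV] := witness_eigenVE.
rewrite (cpowE _ Su witnessE) conj_diagE SV.
rewrite !big_ord_recl big_ord0 !mxE /= powR1.
have -> : (9 : R) = 3 * 3 by lra.
rewrite powRM//; lra.
Qed.

End GDNPower.

Theorem corollary4p5 (R : realType) : is_critical_exponent 3 (2 : R).
Proof.
split.
  by split=> // A GA a a2; apply: GDN_cpow3 => //; exact: ltW.
move=> m [m0 mP]; rewrite leNgt; apply/negP => m2.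
(* The maximum with 1 keeps [t] inside the interval (1, 2), where the entry is negative. *)
pose t := (Num.max m 1 + 2) / 2.
have [mt t1 t2] : [/\ m < t, 1 < t & t < 2].
  rewrite /t; have : m <= Num.max m 1 by rewrite le_max lexx.
  have : 1 <= Num.max m 1 by rewrite le_max lexx orbT.
  have : Num.max m 1 < 2 by rewrite gt_max m2; lra.
  by split; lra.
have [/(_ 0 0)] := mP _ (GDN_witness R) _ mt.
have lt3 u v : u < v -> 3 `^ u < 3 `^ v :> R.
  by move=> uv; rewrite /powR gt_eqF// ltr_expR ltr_pM2r// ln_gt0//; lra.
have X3 : 3 < 3 `^ t by rewrite -{1}[3]powRr1//; exact: lt3.
have X9 : 3 `^ t < 9.
  have -> : 9 = 3 `^ 2 :> R by rewrite powR_mulrn//; lra.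
  exact: lt3.
rewrite cpow_witness; nra.
Qed.
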